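(* Let $\psi:N^2\to\mathbb{R}^3$, $(v,w)\mapsto(v,w,f(v,w))$, be a hyperbolic paraboloid with affine normal $(0,0,1)$. Define $\varphi(t,v,w)=(tv,tw,tf(v,w)-ct^4,t)$ or $\varphi(t,v,w)=(v,w,f(v,w)+ct^3,t^4)$, where $t\in\mathbb{R}^+$ and $c\neq0$. Then $\varphi$ defines a $3$-dimensional indefinite improper affine hypersphere which admits a pointwise $\mathrm{SO}(1,1)$-symmetry.
   Context: Setting: for a nondegenerate hypersurface $\varphi:M^3\to\mathbb{R}^4$ with Blaschke normal $\xi$, $D_X\varphi_*Y=\varphi_*(\nabla_XY)+h(X,Y)\xi$ and $D_X\xi=-\varphi_*(SX)$ define affine metric $h$ and shape operator $S$; $K=\nabla-\hat\nabla$ is the difference tensor ($\hat\nabla$ Levi-Civita of $h$). Affine hypersphere: $S=H\,\mathrm{Id}$, $H$ constant; improper if $H=0$; indefinite if $h$ is indefinite (Lorentzian). Pointwise $G$-symmetry: for every $p$ the group of $h_p$-isometries $L$ of $T_pM$ with $\det L=1$ and $K_p(LX,LY)=LK_p(X,Y)$ is isomorphic to $G$. *)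

(* Defs.v *)
From HB Require Import structures.
From mathcomp Require Import all_boot all_order all_algebra.
From mathcomp Require Import all_classical all_reals all_analysis.
Set Implicit Arguments. Unset Strict Implicit. Unset Printing Implicit Defensive.
Import Order.TTheory GRing.Theory Num.Theory.
Local Open Scope ring_scope.

(* Coordinates: a parametrized hypersurface is phi : 'rV_n -> 'rV_(n.+1),
   defined on a domain U : set 'rV_n.  Tangent vectors at a point are row
   vectors X : 'rV_n in the coordinate basis (d_0,...,d_(n-1)); a linear map L
   of T_pM acts on row vectors by X |-> X *m L. *)

Definition ev {R : nzRingType} n (i : 'I_n) : 'rV[R]_n := delta_mx 0 i.

Definition pd {R : realType} n (i : 'I_n) (F : 'rV[R]_n -> R) : 'rV[R]_n -> R :=
  fun x => derive1 (fun s : R => F (x + s *: ev i)) 0.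

Definition pdable {R : realType} n (i : 'I_n) (F : 'rV[R]_n -> R) (x : 'rV[R]_n) :=
  derivable (fun s : R => F (x + s *: ev i)) 0 1.

Definition itpd {R : realType} n (l : seq 'I_n) (F : 'rV[R]_n -> R) :=
  foldr (@pd R n) F l.

Definition smooth_on {R : realType} n (U : set 'rV[R]_n) (F : 'rV[R]_n -> R) :=
  forall (l : seq 'I_n) (i : 'I_n) x, U x -> pdable i (itpd l F) x.

Definition vsmooth_on {R : realType} n m (U : set 'rV[R]_n)
  (F : 'rV[R]_n -> 'rV[R]_m) := forall k : 'I_m, smooth_on U (fun y => F y 0 k).

Definition dv {R : realType} n m (i : 'I_n) (F : 'rV[R]_n -> 'rV[R]_m) :
  'rV[R]_n -> 'rV[R]_m := fun x => \row_k pd i (fun y => F y 0 k) x.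

Section Blaschke.
Context {R : realType} {n : nat}.
Variables (phi xi : 'rV[R]_n -> 'rV[R]_n.+1).

Definition frame (x : 'rV[R]_n) : 'M[R]_n.+1 :=
  \matrix_(a < n.+1, k < n.+1)
    match unlift ord_max a with
    | Some j => dv j phi x 0 k
    | None => xi x 0 k
    end.

Definition coord_t (x : 'rV[R]_n) (v : 'rV[R]_n.+1) (k : 'I_n) : R :=
  (v *m invmx (frame x)) 0 (lift ord_max k).
Definition coord_n (x : 'rV[R]_n) (v : 'rV[R]_n.+1) : R :=
  (v *m invmx (frame x)) 0 ord_max.

(* Gauss formula  D_{d_i} phi_* d_j = phi_*(nabla_{d_i} d_j) + h(d_i,d_j) xi *)
Definition affine_metric (x : 'rV[R]_n) : 'M[R]_n :=
  \matrix_(i, j) coord_n x (dv i (dv j phi) x).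
Definition christoffel (x : 'rV[R]_n) (i j k : 'I_n) : R :=
  coord_t x (dv i (dv j phi) x) k.

(* Weingarten formula  D_{d_i} xi = - phi_*(S d_i) + tau(d_i) xi.
   shape_op x is the matrix of S acting on row vectors. *)
Definition shape_op (x : 'rV[R]_n) : 'M[R]_n :=
  \matrix_(i, k) - coord_t x (dv i xi x) k.
Definition transversal_form (x : 'rV[R]_n) (i : 'I_n) : R :=
  coord_n x (dv i xi x).

Definition lc_christoffel (x : 'rV[R]_n) (i j k : 'I_n) : R :=
  2^-1 * \sum_(l < n) invmx (affine_metric x) k l *
     (pd i (fun y => affine_metric y j l) x + pd j (fun y => affine_metric y i l) x
      - pd l (fun y => affine_metric y i j) x).

Definition diff_tensor (x : 'rV[R]_n) (X Y : 'rV[R]_n) : 'rV[R]_n :=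
  \row_k \sum_(i < n) \sum_(j < n)
     X 0 i * Y 0 j * (christoffel x i j k - lc_christoffel x i j k).

Definition is_blaschke_normal (U : set 'rV[R]_n) :=
  vsmooth_on U phi /\ vsmooth_on U xi /\
  forall x, U x ->
    [/\ \det (frame x) != 0,                       (* immersion + transversality *)
        \det (affine_metric x) != 0,
        (forall i, transversal_form x i = 0)
      & (\det (frame x)) ^+ 2 = `|\det (affine_metric x)|].

(* affine hypersphere S = H Id, H constant; improper: H = 0 *)
Definition improper_affine_hypersphere (U : set 'rV[R]_n) :=
  forall x, U x -> shape_op x = 0.

Definition indefinite (U : set 'rV[R]_n) :=
  forall x, U x -> exists X Y : 'rV[R]_n,
    0 < (X *m affine_metric x *m X^T) 0 0 /\ (Y *m affine_metric x *m Y^T) 0 0 < 0.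

Definition sym_group (x : 'rV[R]_n) : set 'M[R]_n :=
  [set L | L *m affine_metric x *m L^T = affine_metric x /\ \det L = 1 /\
           forall X Y, diff_tensor x (X *m L) (Y *m L) = diff_tensor x X Y *m L].

End Blaschke.

Definition lorentz2 {R : realType} : 'M[R]_2 :=
  diag_mx (\row_(i < 2) (if i == 0 then 1 else -1)).

Definition SO11 {R : realType} : set 'M[R]_2 :=
  [set M | M *m lorentz2 *m M^T = lorentz2 /\ \det M = 1].

(* A and B (sets of matrices that are groups under matrix product) are
   isomorphic as groups *)
Definition group_isomorphic {R : realType} m k (A : set 'M[R]_m) (B : set 'M[R]_k) :=
  exists theta : 'M[R]_m -> 'M[R]_k,
    [/\ (forall M, A M -> B (theta M)),
        (forall M N, A M -> A N -> theta M = theta N -> M = N),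
        (forall L, B L -> exists2 M, A M & theta M = L)
      & (forall M N, A M -> A N -> theta (M *m N) = theta M *m theta N)].

Definition pointwise_SO11_symmetry {R : realType} n
  (phi xi : 'rV[R]_n -> 'rV[R]_n.+1) (U : set 'rV[R]_n) :=
  forall x, U x -> group_isomorphic SO11 (sym_group phi xi x).

Definition mkrow {R : realType} (m : nat) (s : seq R) : 'rV[R]_m :=
  \row_(i < m) nth 0 s i.

(* Main.v *)
(* Both hypersurfaces have a constant affine normal, [(0,0,m,0)] resp. [(0,0,0,m)],
   so they are improper affine spheres as soon as [m] is scaled to satisfy the
   volume condition; that [m] does not depend on the point is where the
   exponents of [t] matter.  In both cases the affine metric is a warped product
   [h = A t^2 dt^2 + t B], with [B] a constant multiple of the Hessian of [f],
   and, up to sign, the difference tensor is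
     [K(T,T) = - T / t], [K(T,Y) = Y / (2t)], [K(Y,Z) = B(Y,Z) / (2 A t^2) T]
   for [T = d/dt] and [Y], [Z] tangent to the paraboloid.  Comparing [K(LT,LT)] with
   [L K(T,T)] shows that a symmetry [L] fixes [T], so it also preserves the
   [h]-orthogonal plane and restricts there to an isometry of [B] with determinant
   1.  Diagonalising the Lorentzian form [B] identifies this group with SO(1,1). *)

Require Import Defs.
From HB Require Import structures.
From mathcomp Require Import all_boot all_order all_algebra.
From mathcomp Require Import all_classical all_reals all_analysis.
From mathcomp Require Import ring lra.
Import Order.TTheory GRing.Theory Num.Theory.
Import numFieldNormedType.Exports.
Local Open Scope classical_set_scope.
Local Open Scope ring_scope.

(** * Symbolic differentiation of polynomial maps *)

(* Reified polynomials: iterated partial derivatives become symbolic, hence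
   computable by [simpl]. *)
Inductive pexpr (R : Type) : Type :=
  | Cst of R
  | Var of nat
  | Add of pexpr R & pexpr R
  | Mul of pexpr R & pexpr R.
Arguments Cst {R}. Arguments Var {R}. Arguments Add {R}. Arguments Mul {R}.

Fixpoint eval {R : realType} {n : nat} (p : pexpr R) (x : 'rV[R]_n.+1) : R :=
  match p with
  | Cst a => a
  | Var j => x 0 (inord j)
  | Add p q => eval p x + eval q x
  | Mul p q => eval p x * eval q x
  end.

Fixpoint dpe {R : realType} (i : nat) (p : pexpr R) : pexpr R :=
  match p with
  | Cst _ => Cst 0
  | Var j => Cst (if i == j then 1 else 0)
  | Add p q => Add (dpe i p) (dpe i q)
  | Mul p q => Add (Mul (dpe i p) q) (Mul p (dpe i q))
  end.

(** [Var j] is read through [inord], which falls back to coordinate 0 when [j] is out of range,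
    whereas [dpe] compares raw indices. The symbolic derivative is therefore guarded by this bound
    on the variables. *)
Fixpoint vars_lt {R : Type} (n : nat) (p : pexpr R) : bool :=
  match p with
  | Cst _ => true
  | Var j => (j < n)%N
  | Add p q | Mul p q => vars_lt n p && vars_lt n q
  end.

Lemma vars_lt_dpe {R : realType} n i (p : pexpr R) :
  vars_lt n p -> vars_lt n (dpe i p).
Proof.
by elim: p => //= p IHp q IHq /andP[hp hq]; rewrite ?IHp ?IHq ?hp ?hq.
Qed.

Lemma is_derive_eval {R : realType} n (i : 'I_n.+1) (p : pexpr R)
    (x : 'rV[R]_n.+1) : vars_lt n.+1 p ->
  is_derive (0 : R) 1 (fun s : R => eval p (x + s *: ev i)) (eval (dpe i p) x).
Proof.
elim: p => [a|j|p IHp q IHq|p IHp q IHq] /=.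
- by move=> _; exact: is_derive_cst.
- move=> hj.
  have -> : (fun s : R => (x + s *: ev i) 0 (inord j)) =
      cst (x 0 (inord j)) + (if (i : nat) == j then 1 else 0 : R) *: id.
    apply/funext => s; rewrite !mxE eqxx /= -val_eqE /= inordK // eq_sym.
    rewrite fctE /= fctE; congr (_ + _); rewrite /GRing.scale /= mulrC.
    by case: eqP.
  apply: (is_derive_eq (is_deriveD (is_derive_cst _ _ _)
    (is_deriveZ _ (is_derive_id _ _)))).
  by rewrite add0r; case: eqP => _; rewrite /GRing.scale /= mulr1.
- move=> /andP[/IHp hp /IHq hq].
  exact: is_deriveD.
- move=> /andP[/IHp hp /IHq hq].
  apply: (is_derive_eq (is_deriveM hp hq)).
  by rewrite scale0r addr0 addrC /GRing.scale /=; congr (_ + _); exact: mulrC.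
Qed.

Lemma pd_eval {R : realType} n (i : 'I_n.+1) (p : pexpr R) : vars_lt n.+1 p ->
  pd i (@eval R n p) = eval (dpe i p).
Proof.
move=> hp; apply/funext => x; rewrite /pd derive1E.
by have := is_derive_eval n i p x hp => /@derive_val ->.
Qed.

Lemma itpd_eval {R : realType} n (l : seq 'I_n.+1) (p : pexpr R) :
  vars_lt n.+1 p ->
  exists2 q : pexpr R, vars_lt n.+1 q & itpd l (@eval R n p) = eval q.
Proof.
move=> hp; elim: l => [|i l [q hq IH]]; first by exists p.
by exists (dpe i q); [exact: vars_lt_dpe|rewrite /= IH pd_eval].
Qed.

Lemma smooth_eval {R : realType} n (U : set 'rV[R]_n.+1) (p : pexpr R) :
  vars_lt n.+1 p -> smooth_on U (eval p).
Proof.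
move=> hp l i x _; have [q hq ->] := itpd_eval n l p hp.
by have [] := is_derive_eval n i q x hq.
Qed.

Definition evalv {R : realType} n m (s : seq (pexpr R)) (x : 'rV[R]_n.+1) :
  'rV[R]_m := \row_k eval (nth (Cst 0) s k) x.

Definition vec_lt {R : Type} n (s : seq (pexpr R)) := all (vars_lt n) s.

Lemma vars_lt_nth {R : realType} n (s : seq (pexpr R)) k :
  vec_lt n s -> vars_lt n (nth (Cst 0) s k).
Proof.
move=> /(all_nthP (Cst 0)) hs; case: (ltnP k (size s)) => hk; first exact: hs.
by rewrite nth_default.
Qed.

Lemma vec_lt_dpe {R : realType} n i (s : seq (pexpr R)) :
  vec_lt n s -> vec_lt n (map (dpe i) s).
Proof.
by elim: s => //= p s IH /andP[hp hs]; rewrite vars_lt_dpe //= IH.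
Qed.

Lemma evalv_fun {R : realType} n m (s : seq (pexpr R)) (k : 'I_m) :
  (fun y => evalv n m s y 0 k) = eval (nth (Cst 0) s k).
Proof. by apply/funext => y; rewrite mxE. Qed.

Lemma vsmooth_evalv {R : realType} n m (U : set 'rV[R]_n.+1)
  (s : seq (pexpr R)) : vec_lt n.+1 s -> vsmooth_on U (evalv n m s).
Proof.
by move=> hs k; rewrite evalv_fun; apply/smooth_eval/vars_lt_nth.
Qed.

Lemma dv_evalv {R : realType} n m (i : 'I_n.+1) (s : seq (pexpr R)) :
  vec_lt n.+1 s -> dv i (evalv n m s) = evalv n m (map (dpe i) s).
Proof.
move=> hs; apply/funext => x; apply/rowP => k.
rewrite !mxE evalv_fun pd_eval; last exact: vars_lt_nth.
congr (eval _ x); case: (ltnP k (size s)) => hk; first by rewrite (nth_map (Cst 0)).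
by rewrite !nth_default ?size_map.
Qed.

(** * Locality of derivatives and coordinates in the moving frame *)

(** A partial derivative depends only on the germ of the function, and the half-space is open. This
    allows the metric to be differentiated although its formula is known only for [t > 0]. *)
Lemma pd_eq_on {R : realType} n (i : 'I_n.+1) (F G : 'rV[R]_n.+1 -> R)
    (x : 'rV[R]_n.+1) :
  (forall y : 'rV[R]_n.+1, 0 < y 0 0 -> F y = G y) -> 0 < x 0 0 -> pd i F x = pd i G x.
Proof.
move=> FG x0; rewrite /pd !derive1E; apply: near_eq_derive.
have i0 : inord 0 = 0 :> 'I_n.+1 by apply/val_inj; rewrite /= inordK.
(* The first coordinate along the line is the polynomial [Var 0], hence continuous in [s], so it
   stays positive near [s = 0]. *)
have [/derivable1_diffP/differentiable_continuous h _] :=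
  is_derive_eval n i (Var 0) x isT.
have {}h : (x + s *: ev i) 0 (inord 0) @[s --> (0 : R)] -->
  (x + (0 : R) *: ev i) 0 (inord 0) := h.
rewrite i0 scale0r addr0 in h.
near=> s; apply: FG; near: s.
exact: (cvgr_gt _ h).
Unshelve. all: by end_near.
Qed.

Lemma mulmx_frame {R : realType} n (phi xi : 'rV[R]_n -> 'rV[R]_n.+1) x
    (u : 'rV[R]_n.+1) :
  u *m frame phi xi x =
  \sum_(j < n) u 0 (lift ord_max j) *: dv j phi x + u 0 ord_max *: xi x.
Proof.
apply/rowP => k; rewrite !mxE big_ord_recr summxE /=; congr (_ + _).
  apply: eq_bigr => j _.
  have -> : widen_ord (leqnSn n) j = lift ord_max j.
    by apply: ord_inj; rewrite lift_max.
  by rewrite !mxE liftK mxE.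
by rewrite mxE unlift_none.
Qed.

(** An invertible frame gives unique coefficients, so the Gauss formula can be checked by exhibiting
    a decomposition, without ever computing [invmx (frame x)]. *)
Lemma coord_frame {R : realType} n (phi xi : 'rV[R]_n -> 'rV[R]_n.+1) x v
    (al : 'I_n -> R) (be : R) :
  \det (frame phi xi x) != 0 ->
  v = \sum_j al j *: dv j phi x + be *: xi x ->
  (forall k, coord_t phi xi x v k = al k) /\ coord_n phi xi x v = be.
Proof.
move=> hd ->.
pose u : 'rV[R]_n.+1 := \row_a (if unlift ord_max a is Some j then al j else be).
have -> : \sum_j al j *: dv j phi x + be *: xi x = u *m frame phi xi x.
  rewrite mulmx_frame mxE unlift_none; congr (_ + _).
  by apply: eq_bigr => j _; rewrite mxE liftK.
have hu : frame phi xi x \in unitmx by rewrite unitmxE unitfE.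
rewrite /coord_t /coord_n mulmxK // mxE unlift_none; split => // k.
by rewrite mxE liftK.
Qed.

Lemma frame_evalv {R : realType} n (s z : seq (pexpr R)) (x : 'rV[R]_n.+1) a k :
  vec_lt n.+1 s ->
  frame (evalv n n.+2 s) (evalv n n.+2 z) x a k =
  eval (nth (Cst 0) (if (a < n.+1)%N then map (dpe a) s else z) k) x.
Proof.
move=> hs; rewrite mxE; case: unliftP => [j ->|->].
  by rewrite lift_max ltn_ord dv_evalv // mxE.
by rewrite /= ltnn mxE.
Qed.

(** * Small determinants and Lorentzian forms on the plane *)

(** Entries are indexed by [nat], so that the indices of minors reduce by computation rather than
    through lifted ordinals. *)
Definition det3 {R : comPzRingType} (m : nat -> nat -> R) : R :=
  m 0%N 0%N * (m 1%N 1%N * m 2%N 2%N - m 1%N 2%N * m 2%N 1%N)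
  - m 0%N 1%N * (m 1%N 0%N * m 2%N 2%N - m 1%N 2%N * m 2%N 0%N)
  + m 0%N 2%N * (m 1%N 0%N * m 2%N 1%N - m 1%N 1%N * m 2%N 0%N).

Lemma det_mx33 {R : comPzRingType} (M : 'M[R]_3) (m : nat -> nat -> R) :
  (forall i j : 'I_3, M i j = m i j) -> \det M = det3 m.
Proof.
move=> hM; rewrite /det3.
do 3 rewrite !(expand_det_row _ ord0) !big_ord_recl !big_ord0 /cofactor.
rewrite !det_mx00 !mxE !hM /= /bump /=.
rewrite !(expr0, expr1, exprS, addn0, add0n, addn1); ring.
Qed.

Lemma det_mx44 {R : comPzRingType} (M : 'M[R]_4) (m : nat -> nat -> R) :
  (forall i j : 'I_4, M i j = m i j) ->
  \det M = \sum_(k < 4) m 0%N k * ((-1) ^+ k * det3 (fun i j => m i.+1 (bump k j))).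
Proof.
move=> hM; rewrite (expand_det_row _ ord0); apply: eq_bigr => k _.
rewrite hM /cofactor /= add0n; congr (_ * (_ * _)).
by apply: det_mx33 => i j; rewrite !mxE hM lift0.
Qed.

Lemma det_mx22 {R : comPzRingType} (M : 'M[R]_2) :
  \det M = M 0 0 * M 1 1 - M 0 1 * M 1 0.
Proof.
rewrite (expand_det_row _ ord0) !big_ord_recl big_ord0 /cofactor !det_mx11 !mxE /=.
have -> : lift 0 0 = 1 :> 'I_2 by apply: ord_inj.
have -> : lift 1 0 = 0 :> 'I_2 by apply: ord_inj.
rewrite /= !(expr0, expr1, addn0, add0n, addn1); ring.
Qed.

Lemma eq_mx22 {R : Type} (M N : 'M[R]_2) :
  M 0 0 = N 0 0 -> M 0 1 = N 0 1 -> M 1 0 = N 1 0 -> M 1 1 = N 1 1 -> M = N.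
Proof.
move=> h00 h01 h10 h11; apply/matrixP.
have H (i : 'I_2) : i = 0 \/ i = 1.
  by case: i => [[|[|//]] hi]; [left|right]; exact: ord_inj.
by move=> i j; case: (H i) => ->; case: (H j) => ->.
Qed.

Definition mx22 {R : Type} (p q r s : R) : 'M[R]_2 :=
  \matrix_(i, j) if (i : nat) == 0%N then if (j : nat) == 0%N then p else q
                 else if (j : nat) == 0%N then r else s.

Lemma mulmx22 {R : pzRingType} (p q r s p' q' r' s' : R) :
  mx22 p q r s *m mx22 p' q' r' s' =
  mx22 (p * p' + q * r') (p * q' + q * s') (r * p' + s * r') (r * q' + s * s').
Proof. by apply: eq_mx22; rewrite !mxE !big_ord_recl big_ord0 !mxE /= addr0. Qed.

Lemma tr_mx22 {R : Type} (p q r s : R) : (mx22 p q r s)^T = mx22 p r q s.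
Proof. by apply: eq_mx22; rewrite !mxE. Qed.

Lemma lorentz2E {R : realType} : lorentz2 = mx22 1 0 0 (- 1) :> 'M[R]_2.
Proof. by apply: eq_mx22; rewrite !mxE //= ?mulr1n ?mulr0n. Qed.

(** A negative determinant means signature (1,1). The rows of [P] are two vectors of the standard
    Lorentz plane with the prescribed Gram matrix; the first is put on the positive axis, the
    negative axis or the null cone according to the sign of [p]. *)
Lemma lorentz_factor {R : realType} (p q r : R) : p * r - q ^+ 2 < 0 ->
  exists P : 'M[R]_2, P *m lorentz2 *m P^T = mx22 p q q r.
Proof.
move=> hD; rewrite lorentz2E.
have H u v w z : u ^+ 2 - v ^+ 2 = p -> u * w - v * z = q -> w ^+ 2 - z ^+ 2 = r ->
    exists P : 'M[R]_2, P *m mx22 1 0 0 (- 1) *m P^T = mx22 p q q r.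
  move=> <- <- <-; exists (mx22 u v w z).
  by rewrite tr_mx22 !mulmx22; congr mx22; ring.
case: (ltrgt0P p) => [p0|p0|p0].
- have e : Num.sqrt p ^+ 2 = p by rewrite sqr_sqrtr // ltW.
  have s0 : Num.sqrt p != 0 by rewrite gt_eqF // sqrtr_gt0.
  apply: (H (Num.sqrt p) 0 (q / Num.sqrt p) (Num.sqrt ((q ^+ 2 - p * r) / p))).
  + by rewrite e; ring.
  + by field.
  + rewrite sqr_sqrtr; last by rewrite divr_ge0 ?ltW //; lra.
    by rewrite expr_div_n e; field; rewrite gt_eqF.
- have e : Num.sqrt (- p) ^+ 2 = - p by rewrite sqr_sqrtr // oppr_ge0 ltW.
  have s0 : Num.sqrt (- p) != 0 by rewrite gt_eqF // sqrtr_gt0 oppr_gt0.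
  apply: (H 0 (Num.sqrt (- p)) (Num.sqrt ((q ^+ 2 - p * r) / - p))
            (- q / Num.sqrt (- p))).
  + by rewrite e; ring.
  + by field.
  + rewrite sqr_sqrtr; last by rewrite divr_ge0 ?oppr_ge0 ?ltW //; lra.
    by rewrite expr_div_n e; field; rewrite lt_eqF.
- have q0 : q != 0 by apply: contraTneq hD => ->; rewrite p0 mul0r expr0n subrr ltxx.
  (* The first row is the null vector [(1, 1)]; the second row [(w, z)] solves [w - z = q] and
     [w + z = r / q]. *)
  apply: (H 1 1 ((r / q + q) / 2) ((r / q - q) / 2)).
  + by rewrite p0; ring.
  + by field.
  + by field.
Qed.

(** * The symmetry group of the warped model at a point *)

(** The size [1 + 2] is convertible to [3] and exposes the splitting into the line of [T] and the
    tangent plane of the paraboloid. *)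
Definition warped_metric {R : realType} (A : R) (B : 'M[R]_2) (t : R) : 'M[R]_(1 + 2) :=
  block_mx (A * t ^+ 2)%:M 0 0 (t *: B).

Definition warped_K {R : realType} (A : R) (B : 'M[R]_2) (t : R)
    (X Y : 'rV[R]_(1 + 2)) : 'rV[R]_(1 + 2) :=
  row_mx ((2 * A * t ^+ 2)^-1 *: (rsubmx X *m B *m (rsubmx Y)^T)
          - t^-1 *: (lsubmx X *m lsubmx Y))
         ((2 * t)^-1 *: (lsubmx X *m rsubmx Y + lsubmx Y *m rsubmx X)).

Definition warped_sym {R : realType} (A : R) (B : 'M[R]_2) (s t : R) :
    set 'M[R]_(1 + 2) :=
  [set L | L *m warped_metric A B t *m L^T = warped_metric A B t /\ \det L = 1 /\
     forall X Y, s *: warped_K A B t (X *m L) (Y *m L) = s *: warped_K A B t X Y *m L].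

(** Write [LT = al T + Y] and [be = B(Y,Y)]. The isometry condition on [T] gives [e1]; the two
    components of [K(LT,LT) = L K(T,T)] give [e2] and [e3]. Together they force [be = 0], then
    [al = 1] and [Y = 0]. The nonzero factor [s] cancels, so both immersions are covered. *)
Lemma warped_symE {R : realType} (A : R) (B : 'M[R]_2) (s t : R) L :
  t != 0 -> A != 0 -> s != 0 ->
  warped_sym A B s t L <->
  exists N, [/\ L = block_mx 1%:M 0 0 N, N *m B *m N^T = B & \det N = 1].
Proof.
move=> t0 A0 s0; split; last first.
  move=> [N [-> hN dN]]; split; last split.
  - rewrite /warped_metric tr_block_mx !mulmx_block !trmx1 !trmx0.
    rewrite !(mulmx0, mul0mx, addr0, add0r, mulmx1, mul1mx).
    by rewrite -scalemxAr -scalemxAl hN.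
  - by rewrite det_ublock det1 mul1r.
  - move=> X Y; rewrite -scalemxAl; congr (_ *: _).
    rewrite -[X]hsubmxK -[Y]hsubmxK. rewrite !mul_row_block /warped_K.
    rewrite !row_mxKl !row_mxKr !(mulmx0, mul0mx, addr0, add0r, mulmx1, mul1mx).
    by rewrite trmx_mul -scalemxAl mulmxDl -{2}hN !mulmxA.
move=> [hI [hd hK]].
(* Equivariance is used only at the pair [(T, T)]. *)
have := hK (row_mx 1%:M 0) (row_mx 1%:M 0); move: hI hd {hK}; rewrite -[L]submxK.
set a := ulsubmx _; set Y := ursubmx _; set C := dlsubmx _; set N := drsubmx _.
clearbody a Y C N.
rewrite -scalemxAl => hI hd /(scalerI s0).
rewrite mul_row_block /warped_K !row_mxKl !row_mxKr.
rewrite !(mulmx0, mul0mx, addr0, add0r, mulmx1, mul1mx, trmx0, scaler0, sub0r).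
rewrite mul_row_block !(mulmx0, mul0mx, addr0, add0r, mulmx1, mul1mx, trmx0, scaler0).
move=> /eq_row_mx[hK0 hK1].
move: hI; rewrite /warped_metric tr_block_mx !mulmx_block.
rewrite !(mulmx0, mul0mx, addr0, add0r).
move=> /eq_block_mx[h1 h2 h3 h4].
have ea : a = (a 0 0)%:M by exact: mx11_scalar.
move: (a 0 0) ea => al ea; rewrite {a}ea in hd hK0 hK1 h1 h2 h3 h4 *.
have [be ebe] : exists be, Y *m B *m Y^T = be%:M.
  by exists ((Y *m B *m Y^T) 0 0); exact: mx11_scalar.
have e1 : al ^+ 2 * (A * t ^+ 2) + t * be = A * t ^+ 2.
  move: h1; rewrite -scalemxAr -scalemxAl ebe tr_scalar_mx -!scalar_mxM.
  move=> /matrixP/(_ 0 0); rewrite !mxE !mulr1n => h; rewrite -[RHS]h; ring.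
have e2 : be / (2 * A * t ^+ 2) - al ^+ 2 / t = - al / t.
  move: hK0; rewrite ebe mulNmx -scalemxAl mul1mx -scalar_mxM.
  move=> /matrixP/(_ 0 0); rewrite !mxE !mulr1n => h.
  by rewrite mulrC expr2 -[al * al / t]mulrC h mulNr mulrC.
have {hK1} e3 : (al + 1) *: Y = 0.
  move: hK1; rewrite mulNmx -scalemxAl mul1mx !mul_scalar_mx => /rowP h.
  apply/rowP => j; have := h j; rewrite !mxE => {}h.
  have -> : (al + 1) * Y 0 j =
    t * ((2 * t)^-1 * (al * Y 0 j + al * Y 0 j) + t^-1 * Y 0 j) by field.
  by rewrite h addNr mulr0.
(* If [Y] is nonzero then [al = -1], and [e1] forces [be = 0] again; this is
   later excluded by [e2]. *)
have be0 : be = 0.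
  move/eqP: e3; rewrite scaler_eq0 => /orP[/eqP al1|/eqP Y0].
    have : t * be = 0 by move: e1; rewrite (_ : al = - 1); [lra|lra].
    by move/eqP; rewrite mulf_eq0 (negbTE t0) => /eqP.
  by move: ebe; rewrite Y0 !mul0mx => /matrixP/(_ 0 0); rewrite !mxE mulr1n.
rewrite be0 mulr0 addr0 mul0r sub0r in e1 e2.
have al2 : al ^+ 2 = 1.
  by apply: (mulIf (_ : A * t ^+ 2 != 0)); rewrite ?mul1r // mulf_neq0 // expf_neq0.
have al1 : al = 1.
  by rewrite -al2; apply: (mulIf (invr_neq0 t0)); apply: oppr_inj; rewrite e2 mulNr.
have Y0 : Y = 0.
  move/eqP: e3; rewrite al1 scaler_eq0 (_ : (1 + 1 == 0 :> R) = false) ?orFb.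
    by move/eqP.
  by rewrite -[1 + 1]/(2%:R) pnatr_eq0.
rewrite Y0 al1 in hd h3 h4 *.
(* With [Y = 0] and [al = 1], the lower left block of the isometry equation is [A t^2 C = 0]: the
   plane orthogonal to [T] is preserved. *)
have C0 : C = 0.
  move: h3; rewrite trmx0 mulmx0 addr0 tr_scalar_mx mulmx1 mul_mx_scalar.
  by move/eqP; rewrite scaler_eq0 mulf_eq0 (negbTE A0) expf_eq0 (negbTE t0) => /eqP.
rewrite C0 in hd h4 *.
exists N; split => //.
  move: h4; rewrite !mul0mx add0r -scalemxAr -scalemxAl.
  exact: scalerI.
by move: hd; rewrite det_ublock det1 mul1r.
Qed.

(** Since [B = P lorentz2 P^T], conjugation by [P] carries isometries of [lorentz2] to isometries of
    [B] and keeps the determinant; the result is extended by the identity on [T]. *)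
Lemma warped_group {R : realType} (A p q r s t : R) :
  t != 0 -> A != 0 -> s != 0 -> p * r - q ^+ 2 < 0 ->
  group_isomorphic SO11 (warped_sym A (mx22 p q q r) s t).
Proof.
move=> t0 A0 s0 hD; have [P hP] := lorentz_factor p q r hD.
(* A singular [P] would make the determinant [p r - q^2] of [P lorentz2 P^T] vanish. *)
have dP : P \in unitmx.
  rewrite unitmxE unitfE; apply: contraTneq hD => dP.
  have := congr1 determinant hP; rewrite !det_mulmx dP !mul0r det_mx22 !mxE /=.
  by rewrite expr2 => <-; rewrite ltxx.
exists (fun M => block_mx 1%:M 0 0 (P *m M *m invmx P)); split.
- move=> M [hM dM]; apply/warped_symE => //; exists (P *m M *m invmx P); split => //.
    rewrite -hP !trmx_mul !mulmxA mulmxKV // -!mulmxA.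
    rewrite (mulmxA P^T) -trmx_mul mulVmx // trmx1 mul1mx.
    by rewrite (mulmxA M) (mulmxA (M *m _)) hM.
  by rewrite !det_mulmx dM mulr1 -det_mulmx mulmxV // det1.
- move=> M N _ _ /eq_block_mx[_ _ _] /(can_inj (mulmxKV dP)).
  exact: (can_inj (mulKmx dP)).
- move=> L /warped_symE[] // N [-> hN dN].
  exists (invmx P *m N *m P); last first.
    by congr block_mx; rewrite !mulmxA mulmxV // mul1mx mulmxK.
  split; last by rewrite !det_mulmx dN mulr1 -det_mulmx mulVmx // det1.
  have -> : lorentz2 = invmx P *m mx22 p q q r *m (invmx P)^T :> 'M[R]_2.
    rewrite -hP !mulmxA mulVmx // mul1mx -mulmxA -trmx_mul mulVmx //.
    by rewrite trmx1 mulmx1.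
  rewrite !trmx_mul !mulmxA mulmxK // -[in RHS]hN !mulmxA.
  rewrite -(mulmxA _ (invmx P)^T P^T) -trmx_mul mulmxV // trmx1 mulmx1.
  by [].
- move=> M N _ _; rewrite mulmx_block !(mulmx0, mul0mx, addr0, add0r, mulmx1).
  by congr block_mx; rewrite !mulmxA mulmxKV.
Qed.

(** Both signs already occur on the plane of [B]: pulling back by [P] the two axes of the Lorentz
    plane gives vectors of square [t] and [- t]. *)
Lemma warped_indefinite {R : realType} (A p q r t : R) :
  0 < t -> p * r - q ^+ 2 < 0 ->
  exists X Y : 'rV[R]_(1 + 2),
    0 < (X *m warped_metric A (mx22 p q q r) t *m X^T) 0 0 /\
    (Y *m warped_metric A (mx22 p q q r) t *m Y^T) 0 0 < 0.
Proof.
move=> t0 hD; have [P hP] := lorentz_factor p q r hD.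
have dP : P \in unitmx.
  rewrite unitmxE unitfE; apply: contraTneq hD => dP.
  have := congr1 determinant hP; rewrite !det_mulmx dP !mul0r det_mx22 !mxE /=.
  by rewrite expr2 => <-; rewrite ltxx.
have H (u : 'rV[R]_2) : let X := row_mx 0 (u *m invmx P) in
   X *m warped_metric A (mx22 p q q r) t *m X^T = t *: (u *m lorentz2 *m u^T).
  rewrite /= mul_row_block !(mulmx0, mul0mx, addr0, add0r) tr_row_mx mul_row_col.
  rewrite !(mulmx0, mul0mx, addr0, add0r) -scalemxAr -scalemxAl -hP !mulmxA.
  rewrite mulmxKV // trmx_mul mulmxA -(mulmxA _ P^T) -trmx_mul mulVmx //.
  by rewrite trmx1 mulmx1.
exists (row_mx 0 (delta_mx 0 0 *m invmx P)), (row_mx 0 (delta_mx 0 1 *m invmx P)).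
rewrite !H !mxE !big_ord_recl !big_ord0 !mxE !big_ord_recl !big_ord0 !mxE /=.
rewrite !(mulr1n, mulr0n, mulr0, mul0r, mulr1, mul1r, addr0, add0r).
split; lra.
Qed.

(** * Levi-Civita connection and difference tensor of the warped metric *)

Local Notation "''J_' k" := (@Ordinal 3 k isT) (at level 8, k at level 2, format "''J_' k").

(** Each case carries the closed bound proof [isT], so that functions defined by matching on the
    index reduce under [simpl]. *)
Lemma ord3_ind (P : 'I_3 -> Prop) : P 'J_0 -> P 'J_1 -> P 'J_2 -> forall i, P i.
Proof.
by move=> P0 P1 P2 [[|[|[|//]]] hi]; rewrite (bool_irrelevance hi isT).
Qed.

Lemma sum_ord3 {V : nmodType} (F : 'I_3 -> V) :
  \sum_i F i = F 'J_0 + F 'J_1 + F 'J_2.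
Proof.
rewrite !big_ord_recl big_ord0 addr0 addrA.
by congr (F _ + F _ + F _); apply: ord_inj.
Qed.

Lemma inord0 n : inord 0 = 0 :> 'I_n.+1.
Proof. by apply: ord_inj; rewrite inordK. Qed.

Definition warped_entry {R : realType} (A p q r : R) (i j : nat) : pexpr R :=
  match i, j with
  | 0%N, 0%N => Mul (Cst A) (Mul (Var 0%N) (Var 0%N))
  | 1%N, 1%N => Mul (Cst p) (Var 0%N)
  | 1%N, 2%N | 2%N, 1%N => Mul (Cst q) (Var 0%N)
  | 2%N, 2%N => Mul (Cst r) (Var 0%N)
  | _, _ => Cst 0
  end.

(* The symbols at [s = 0] are the Levi-Civita ones of [warped_entry]; the induced
   connection has [s = 1] for the cone-like immersion and [s = -1] for the
   graph-like one, and [s] is then the factor of [warped_K] in the difference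
   tensor. *)
Definition warped_gamma {R : realType} (A p q r s t : R) (i j k : nat) : R :=
  match i, j, k with
  | 0%N, 0%N, 0%N => (1 - s) / t
  | 0%N, 1%N, 1%N | 1%N, 0%N, 1%N | 0%N, 2%N, 2%N | 2%N, 0%N, 2%N => (1 + s) / (2 * t)
  | 1%N, 1%N, 0%N => (s - 1) * p / (2 * A * t ^+ 2)
  | 1%N, 2%N, 0%N | 2%N, 1%N, 0%N => (s - 1) * q / (2 * A * t ^+ 2)
  | 2%N, 2%N, 0%N => (s - 1) * r / (2 * A * t ^+ 2)
  | _, _, _ => 0
  end.

Definition warped_mx {R : realType} (A p q r : R) (x : 'rV[R]_3) : 'M[R]_3 :=
  \matrix_(i, j) eval (warped_entry A p q r i j) x.

Lemma vars_lt_warped {R : realType} (A p q r : R) i j :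
  vars_lt 3 (warped_entry A p q r i j).
Proof. by case: i => [|[|[|i]]]; case: j => [|[|[|j]]]. Qed.

Lemma det_warped {R : realType} (A p q r : R) (x : 'rV[R]_3) :
  \det (warped_mx A p q r x) = A * (p * r - q ^+ 2) * x 0 0 ^+ 4.
Proof.
rewrite (det_mx33 _ (fun i j => eval (warped_entry A p q r i j) x)); last first.
  by move=> i j; rewrite mxE.
rewrite /det3 /= inord0; ring.
Qed.

Lemma block_mx_eq {R : Type} m1 m2 n1 n2 (M : 'M[R]_(m1 + m2, n1 + n2)) A B C D :
  ulsubmx M = A -> ursubmx M = B -> dlsubmx M = C -> drsubmx M = D ->
  M = block_mx A B C D.
Proof. by move=> <- <- <- <-; rewrite submxK. Qed.

Lemma row_mx_eq {R : Type} m n1 n2 (M : 'M[R]_(m, n1 + n2)) A B :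
  lsubmx M = A -> rsubmx M = B -> M = row_mx A B.
Proof. by move=> <- <-; rewrite hsubmxK. Qed.

Lemma warped_mxE {R : realType} (A p q r : R) (x : 'rV[R]_3) :
  warped_mx A p q r x = warped_metric A (mx22 p q q r) (x 0 0).
Proof.
apply: (@block_mx_eq R 1 2 1 2); apply/matrixP => i j.
- by rewrite !ord1 !mxE /= inord0 mulr1n expr2.
- by rewrite !mxE; case: i => [[|//] hi]; case: j => [[|[|//]] hj].
- by rewrite !mxE; case: j => [[|//] hj]; case: i => [[|[|//]] hi].
- by rewrite !mxE; case: j => [[|[|//]] hj]; case: i => [[|[|//]] hi];
    rewrite /= inord0 mulrC.
Qed.

(** The inverse metric is never computed: the candidate symbols, with their index lowered by the
    metric, are compared with the symbols of the first kind, and the inverse then cancels. *)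
Lemma lc_warped {R : realType} (phi xi : 'rV[R]_3 -> 'rV[R]_4) (A p q r : R)
    (x : 'rV[R]_3) i j k :
  A != 0 -> p * r - q ^+ 2 != 0 ->
  (forall y : 'rV[R]_3, 0 < y 0 0 -> affine_metric phi xi y = warped_mx A p q r y) ->
  0 < x 0 0 ->
  lc_christoffel phi xi x i j k = warped_gamma A p q r 0 (x 0 0) i j k.
Proof.
move=> A0 D0 hm x0; have t0 : x 0 0 != 0 by rewrite gt_eqF.
have hpd a b c : pd a (fun y => affine_metric phi xi y b c) x =
    eval (dpe a (warped_entry A p q r b c)) x.
  rewrite -pd_eval; last exact: vars_lt_warped.
  by apply: pd_eq_on => // y y0; rewrite hm // mxE.
have hu : warped_mx A p q r x \in unitmx.
  by rewrite unitmxE unitfE det_warped !mulf_neq0 // expf_neq0.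
pose u : 'cV[R]_3 := \col_m (2 * warped_gamma A p q r 0 (x 0 0) i j m).
rewrite /lc_christoffel hm //.
have hc l : pd i (fun y => affine_metric phi xi y j l) x +
   pd j (fun y => affine_metric phi xi y i l) x -
   pd l (fun y => affine_metric phi xi y i j) x = (warped_mx A p q r x *m u) l 0.
  rewrite !hpd mxE sum_ord3 !mxE.
  move: i j l {u}; do 3 (elim/ord3_ind); rewrite /= ?inord0; by field; rewrite ?t0 ?A0.
transitivity (2^-1 * (invmx (warped_mx A p q r x) *m (warped_mx A p q r x *m u)) k 0).
  by congr (_ * _); rewrite [RHS]mxE; apply: eq_bigr => l _; rewrite hc.
by rewrite mulKmx // mxE mulKf // pnatr_eq0.
Qed.

(** The symbols [warped_gamma] are affine in [s], so subtracting their value at [s = 0], the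
    Levi-Civita one, leaves [s] times a fixed tensor. *)
Lemma diff_warped {R : realType} (phi xi : 'rV[R]_3 -> 'rV[R]_4) (A p q r s : R)
    (x X Y : 'rV[R]_3) :
  A != 0 -> p * r - q ^+ 2 != 0 ->
  (forall y : 'rV[R]_3, 0 < y 0 0 -> affine_metric phi xi y = warped_mx A p q r y) ->
  0 < x 0 0 ->
  (forall i j k, christoffel phi xi x i j k = warped_gamma A p q r s (x 0 0) i j k) ->
  diff_tensor phi xi x X Y = s *: warped_K A (mx22 p q q r) (x 0 0) X Y.
Proof.
move=> A0 D0 hm x0 hG; have t0 : x 0 0 != 0 by rewrite gt_eqF.
have hK k : diff_tensor phi xi x X Y 0 k =
    \sum_i \sum_j X 0 i * Y 0 j * (warped_gamma A p q r s (x 0 0) i j k -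
                                  warped_gamma A p q r 0 (x 0 0) i j k).
  rewrite mxE; apply: eq_bigr => i _; apply: eq_bigr => j _.
  by rewrite hG (lc_warped phi xi A p q r).
rewrite /warped_K scale_row_mx.
have e0 i : lshift 2 (i : 'I_1) = 'J_0 by rewrite ord1; apply: ord_inj.
have e1 : rshift 1 (ord0 : 'I_2) = 'J_1 by apply: ord_inj.
have e2 : rshift 1 (lift ord0 ord0 : 'I_2) = 'J_2 by apply: ord_inj.
have ez : ord0 = 0 :> 'I_1 by [].
apply: (@row_mx_eq R 1 1 2); apply/matrixP => i j; rewrite !ord1.
  rewrite [LHS]mxE e0 hK !sum_ord3 !mxE !big_ord_recl !big_ord0 /=.
  rewrite !mxE !big_ord_recl !big_ord0 !mxE /= e1 e2 !e0 ?ez; field.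
  by rewrite A0 t0.
have : j = ord0 \/ j = lift ord0 ord0.
  by case: j => [[|[|//]] hj]; [left|right]; apply: ord_inj.
case=> ->; rewrite [LHS]mxE ?e1 ?e2 hK !sum_ord3 !mxE !big_ord_recl !big_ord0 /=.
  by rewrite !mxE e1 !e0 ?ez; field; rewrite t0.
by rewrite !mxE e2 !e0 ?ez; field; rewrite t0.
Qed.

(** * From the Gauss formula to the geometric properties *)

(** This reduces each immersion to polynomial identities: the volume condition and the Gauss formula
    with constant transversal field [z]. As [xi] is constant, [S] and the transversal form vanish.
    Here [e] is the factor of [warped_K]. *)
Lemma warped_hypersurface {R : realType} (s : seq (pexpr R)) (z : seq R)
    (A p q r e : R) :
  let phi := evalv 2 4 s in let xi := evalv 2 4 (map Cst z) in
  let U := fun x : 'rV[R]_3 => 0 < x 0 0 in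
  vec_lt 3 s -> A != 0 -> p * r - q ^+ 2 < 0 -> e != 0 ->
  (forall x, U x ->
     \det (frame phi xi x) ^+ 2 = `|A * (p * r - q ^+ 2)| * x 0 0 ^+ 4) ->
  (forall x, U x -> forall (i j : 'I_3) (k : 'I_4),
     eval (nth (Cst 0) (map (dpe i) (map (dpe j) s)) k) x =
     \sum_(m < 3) warped_gamma A p q r e (x 0 0) i j m *
                  eval (nth (Cst 0) (map (dpe m) s) k) x +
     eval (warped_entry A p q r i j) x * nth 0 z k) ->
  [/\ is_blaschke_normal phi xi U, improper_affine_hypersphere phi xi U,
      indefinite phi xi U & pointwise_SO11_symmetry phi xi U].
Proof.
move=> phi xi U hs A0 hD e0 hdet hgauss.
have D0 : p * r - q ^+ 2 != 0 by rewrite lt_eqF.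
have hz : vec_lt 3 (map Cst z) by rewrite /vec_lt all_map; apply/allP.
have xiE x k : xi x 0 k = nth 0 z k.
  rewrite mxE; case: (ltnP k (size z)) => hk; first by rewrite (nth_map 0).
  by rewrite !nth_default ?size_map.
have dxi i x : dv i xi x = 0.
  rewrite dv_evalv //; apply/rowP => k; rewrite !mxE -map_comp.
  case: (ltnP k (size z)) => hk; first by rewrite (nth_map 0).
  by rewrite !nth_default ?size_map.
have hd0 x : U x -> \det (frame phi xi x) != 0.
  move=> Ux; rewrite -sqrf_eq0 hdet // mulf_neq0 ?expf_neq0 ?normr_eq0 ?mulf_neq0 //.
  by rewrite gt_eqF.
have hco x (Ux : U x) i j :
    (forall k, christoffel phi xi x i j k = warped_gamma A p q r e (x 0 0) i j k) /\
    affine_metric phi xi x i j = warped_mx A p q r x i j.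
  rewrite [affine_metric _ _ _ _ _]mxE.
  (* One decomposition of the second derivative yields both the connection symbols and the metric
     entry. *)
  apply: coord_frame; first exact: hd0.
  apply/rowP => k; rewrite dv_evalv // dv_evalv; last exact: vec_lt_dpe.
  rewrite mxE hgauss // [RHS]mxE summxE [(_ *: xi x) 0 k]mxE xiE.
  rewrite [warped_mx _ _ _ _ _ _ _]mxE; congr (_ + _).
  by apply: eq_bigr => m _; rewrite [RHS]mxE dv_evalv // mxE.
have hm x : U x -> affine_metric phi xi x = warped_mx A p q r x.
  by move=> Ux; apply/matrixP => i j; have [] := hco x Ux i j.
have t0 (x : 'rV[R]_3) : U x -> x 0 0 != 0 by move=> Ux; rewrite gt_eqF.
split.
- split; first exact: vsmooth_evalv.
  split; first exact: vsmooth_evalv.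
  move=> x Ux; split.
  + exact: hd0.
  + by rewrite hm // det_warped !mulf_neq0 // t0.
  + by move=> i; rewrite /transversal_form dxi /coord_n mul0mx mxE.
  + by rewrite hdet // hm // det_warped [RHS]normrM normrX (gtr0_norm Ux).
- move=> x Ux; apply/matrixP => i k; rewrite !mxE dxi /coord_t mul0mx mxE.
  by rewrite oppr0.
- move=> x Ux; rewrite hm // warped_mxE; exact: warped_indefinite.
- move=> x Ux.
  have -> : sym_group phi xi x = warped_sym A (mx22 p q q r) e (x 0 0).
    have hK X Y : diff_tensor phi xi x X Y =
        e *: warped_K A (mx22 p q q r) (x 0 0) X Y.
      by apply: diff_warped => // i j k; have [] := hco x Ux i j.
    rewrite /sym_group hm // warped_mxE; apply/seteqP; split => L [h1 [h2 h3]];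
      split=> //; split => // X Y; have := h3 X Y; by rewrite !hK.
  by apply: warped_group => //; exact: t0.
Qed.

(** * Normalisation of the affine normals and the two families *)

(** Scaling a transversal field in dimension 3 by [m] multiplies the squared frame determinant by
    [m^2] and [det h] by [m^-3], so the volume condition prescribes [m^5]. *)
Lemma fifth_root {R : realType} (y : R) : 0 < y -> exists2 m : R, 0 < m & m ^+ 5 = y.
Proof.
move=> y0; exists (y `^ (5%:R^-1)); first exact: powR_gt0.
rewrite -powR_mulrn ?powR_ge0 // -powRrM mulVf ?pnatr_eq0 // powRr1 //.
exact: ltW.
Qed.

(** The variable indices are parameters because [f] is used in coordinates 0, 1 for the paraboloid
    and 1, 2 for the hypersurfaces. *)
Definition quadric {R : realType} (a b d e g k : R) (v w : nat) : pexpr R :=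
  Add (Add (Add (Add (Add (Mul (Cst a) (Mul (Var v) (Var v)))
    (Mul (Cst b) (Mul (Var v) (Var w)))) (Mul (Cst d) (Mul (Var w) (Var w))))
    (Mul (Cst e) (Var v))) (Mul (Cst g) (Var w))) (Cst k).

Lemma coordE {R : realType} n (x : 'rV[R]_n.+1) (i : 'I_n.+1) k :
  (i : nat) = k -> x 0 i = x 0 (inord k).
Proof. by move=> <-; rewrite inord_val. Qed.

(** With normal [(0,0,1)] the frame determinant is 1 and the affine metric is the Hessian of [f], so
    the volume condition reads [1 = |4ad - b^2|]; hyperbolicity fixes the sign. Evaluating at the
    origin suffices. *)
Lemma paraboloid_disc {R : realType} (a b d e g k : R) :
  let f := fun v w : R => a * v ^+ 2 + b * v * w + d * w ^+ 2 + e * v + g * w + k in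
  let psi := fun x : 'rV[R]_2 => mkrow 3 [:: x 0 0; x 0 1; f (x 0 0) (x 0 1)] in
  4 * a * d - b ^+ 2 < 0 ->
  is_blaschke_normal psi (fun _ => mkrow 3 [:: 0; 0; 1]) (fun _ => True) ->
  4 * a * d - b ^+ 2 = -1.
Proof.
move=> f psi hD [_ [_ /(_ 0 I)[hd _ _ hB]]].
pose s := [:: Var 0%N; Var 1%N; quadric a b d e g k 0 1].
pose z : seq R := [:: 0; 0; 1].
have epsi : psi = evalv 1 3 s.
  apply/funext => x; apply/rowP => i; rewrite !mxE.
  case: i => [[|[|[|//]]] hi] /=; rewrite ?(@coordE _ _ x 0 0) // ?(@coordE _ _ x 1 1) //.
  by rewrite /f; ring.
have exi : (fun _ : 'rV[R]_2 => mkrow 3 z) = evalv 1 3 (map Cst z).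
  by apply/funext => x; apply/rowP => i; rewrite !mxE; case: i => [[|[|[|//]]] hi].
rewrite -/z epsi exi in hd hB.
have hF (x : 'rV[R]_2) : \det (frame (evalv 1 3 s) (evalv 1 3 (map Cst z)) x) = 1.
  rewrite (det_mx33 _ (fun i j => eval (nth (Cst 0) (if (i < 2)%N then map (dpe i) s
    else map Cst z) j) x)); last by move=> i j; rewrite frame_evalv.
  rewrite /det3 /=; ring.
have hM i j : affine_metric (evalv 1 3 s) (evalv 1 3 (map Cst z)) 0 i j =
   mx22 (2 * a) b b (2 * d) i j.
  rewrite [LHS]mxE; refine (proj2 (coord_frame _ _ _ _ _ (fun=> 0) _ hd _)).
  rewrite big1 ?add0r; last by move=> m _; rewrite scale0r.
  apply/rowP => m; rewrite dv_evalv // dv_evalv // !mxE.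
  by case: i => [[|[|//]] hi]; case: j => [[|[|//]] hj]; case: m => [[|[|[|//]]] hm] /=;
    ring.
move: hB; rewrite hF det_mx22 !hM !mxE /= ltr0_norm; last by lra.
by rewrite expr1n => h; lra.
Qed.

(** On the cone the mixed derivative of [phi] in [t] and [v] is the [v]-derivative divided by [t],
    likewise for [w], and all other second derivatives are multiples of [xi]. This is [warped_gamma]
    at [s = 1]. *)
Lemma cone_hypersurface {R : realType} (a b d e g k c : R) :
  let f := fun v w : R => a * v ^+ 2 + b * v * w + d * w ^+ 2 + e * v + g * w + k in
  let phi := fun x : 'rV[R]_3 =>
    mkrow 4 [:: x 0 0 * x 0 1; x 0 0 * x 0 2;
                x 0 0 * f (x 0 1) (x 0 2) - c * x 0 0 ^+ 4; x 0 0] in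
  let U := fun x : 'rV[R]_3 => 0 < x 0 0 in
  4 * a * d - b ^+ 2 = -1 -> c != 0 ->
  exists xi : 'rV[R]_3 -> 'rV[R]_4,
    [/\ is_blaschke_normal phi xi U, improper_affine_hypersphere phi xi U,
        indefinite phi xi U & pointwise_SO11_symmetry phi xi U].
Proof.
move=> f phi U hD c0.
(* The squared frame determinant is [m^2 t^4], while [|det h|] is [12 |c| t^4 / m^3]. *)
have [m m0 hm] : exists2 m : R, 0 < m & m ^+ 5 = 12 * `|c|.
  by apply: fifth_root; rewrite mulr_gt0 ?normr_gt0 // ltr0n.
have mN0 : m != 0 by rewrite gt_eqF.
pose s : seq (pexpr R) := [:: Mul (Var 0%N) (Var 1%N); Mul (Var 0%N) (Var 2%N);
  Add (Mul (Var 0%N) (quadric a b d e g k 1 2))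
      (Mul (Cst (- c)) (Mul (Mul (Var 0%N) (Var 0%N)) (Mul (Var 0%N) (Var 0%N))));
  Var 0%N].
pose z : seq R := [:: 0; 0; m; 0].
have -> : phi = evalv 2 4 s.
  apply/funext => x; apply/rowP => i; rewrite !mxE.
  case: i => [[|[|[|[|//]]]] hi] /=; rewrite ?(@coordE _ _ x 0 0) // ?(@coordE _ _ x 1 1)
    // ?(@coordE _ _ x 2 2) //.
  by rewrite /f; ring.
exists (evalv 2 4 (map Cst z)).
have eD : 2 * a / m * (2 * d / m) - (b / m) ^+ 2 = - (m ^+ 2)^-1.
  transitivity ((4 * a * d - b ^+ 2) / m ^+ 2); first by field.
  by rewrite hD mulN1r.
apply: (@warped_hypersurface _ s z (- (12 * c) / m) (2 * a / m) (b / m) (2 * d / m) 1) => //.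
- by rewrite mulf_neq0 ?invr_eq0 // oppr_eq0 mulf_neq0 // pnatr_eq0.
- by rewrite eD oppr_lt0 invr_gt0 exprn_gt0.
- move=> x Ux.
  have -> : - (12 * c) / m * (2 * a / m * (2 * d / m) - (b / m) ^+ 2) =
      12 * c / m ^+ 3 by rewrite eD; field.
  rewrite normrM normrM (gtr0_norm (_ : 0 < 12)) ?ltr0n //
    (gtr0_norm (_ : 0 < (m ^+ 3)^-1)); last first.
    by rewrite invr_gt0 exprn_gt0.
  rewrite -hm (det_mx44 _ (fun i j => eval (nth (Cst 0) (if (i < 3)%N then
    map (dpe i) s else map Cst z) j) x)); last by move=> i j; rewrite frame_evalv.
  rewrite !big_ord_recl big_ord0 /det3 /= /bump /= inord0.
  by field.
- move=> x Ux i j l.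
  have t0 : x 0 0 != 0 by rewrite gt_eqF.
  rewrite sum_ord3.
  move: i j l; do 2 (elim/ord3_ind); case=> [[|[|[|[|//]]]] hl]; rewrite /= ?inord0;
    by field; rewrite ?t0 ?mN0 ?c0.
Qed.

(** Here the mixed derivatives in [t] and [v] or [w] vanish, and those within the paraboloid have a
    [T]-component because [(0,0,1,0)] is a combination of the [t]-derivative of [phi] and [xi]. This
    is [warped_gamma] at [s = -1]. *)
Lemma graph_hypersurface {R : realType} (a b d e g k c : R) :
  let f := fun v w : R => a * v ^+ 2 + b * v * w + d * w ^+ 2 + e * v + g * w + k in
  let phi := fun x : 'rV[R]_3 =>
    mkrow 4 [:: x 0 1; x 0 2; f (x 0 1) (x 0 2) + c * x 0 0 ^+ 3; x 0 0 ^+ 4] in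
  let U := fun x : 'rV[R]_3 => 0 < x 0 0 in
  4 * a * d - b ^+ 2 = -1 -> c != 0 ->
  exists xi : 'rV[R]_3 -> 'rV[R]_4,
    [/\ is_blaschke_normal phi xi U, improper_affine_hypersphere phi xi U,
        indefinite phi xi U & pointwise_SO11_symmetry phi xi U].
Proof.
move=> f phi U hD c0.
have c4 : 0 < c ^+ 4 by rewrite exprn_even_gt0.
(* The squared frame determinant is [9 c^2 m^2 t^4], while [|det h|] is [64 t^4 / (9 c^2 m^3)]. *)
have [m m0 hm] : exists2 m : R, 0 < m & m ^+ 5 = 64 / (81 * c ^+ 4).
  by apply: fifth_root; apply: divr_gt0; [|apply: mulr_gt0]; rewrite ?ltr0n.
have mN0 : m != 0 by rewrite gt_eqF.
pose s : seq (pexpr R) := [:: Var 1%N; Var 2%N;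
  Add (quadric a b d e g k 1 2) (Mul (Cst c) (Mul (Var 0%N) (Mul (Var 0%N) (Var 0%N))));
  Mul (Mul (Var 0%N) (Var 0%N)) (Mul (Var 0%N) (Var 0%N))].
pose z : seq R := [:: 0; 0; 0; m].
have -> : phi = evalv 2 4 s.
  apply/funext => x; apply/rowP => i; rewrite !mxE.
  case: i => [[|[|[|[|//]]]] hi] /=; rewrite ?(@coordE _ _ x 0 0) // ?(@coordE _ _ x 1 1)
    // ?(@coordE _ _ x 2 2) //; rewrite /f; ring.
exists (evalv 2 4 (map Cst z)).
(* The [xi]-component of [(0,0,1,0)] is [n t], so [B] is [n] times the Hessian of [f]. *)
pose n := - (4 / (3 * c * m)).
have eD : 2 * a * n * (2 * d * n) - (b * n) ^+ 2 = - (n ^+ 2).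
  transitivity ((4 * a * d - b ^+ 2) * n ^+ 2); first by ring.
  by rewrite hD mulN1r.
have n2 : 0 < n ^+ 2.
  by rewrite exprn_even_gt0 //= oppr_eq0 !mulf_neq0 ?invr_eq0 ?mulf_neq0 ?pnatr_eq0.
apply: (@warped_hypersurface _ s z (4 / m) (2 * a * n) (b * n) (2 * d * n) (- 1)) => //.
- by rewrite mulf_neq0 ?invr_eq0 // pnatr_eq0.
- by rewrite eD oppr_lt0.
- move=> x Ux.
  rewrite eD mulrN normrN gtr0_norm; last first.
    by apply: mulr_gt0 => //; apply: divr_gt0; rewrite ?ltr0n.
  have -> : 4 / m * n ^+ 2 = 9 * c ^+ 2 * m ^+ 2.
    transitivity (64 / (81 * c ^+ 4) * (9 * c ^+ 2 / m ^+ 3)).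
      by rewrite /n; field; rewrite c0 mN0.
    by rewrite -hm; field.
  rewrite (det_mx44 _ (fun i j => eval (nth (Cst 0) (if (i < 3)%N then
    map (dpe i) s else map Cst z) j) x)); last by move=> i j; rewrite frame_evalv.
  rewrite !big_ord_recl big_ord0 /det3 /= /bump /= inord0.
  by ring.
- move=> x Ux i j l; rewrite /n.
  have t0 : x 0 0 != 0 by rewrite gt_eqF.
  rewrite sum_ord3.
  move: i j l; do 2 (elim/ord3_ind); case=> [[|[|[|[|//]]]] hl]; rewrite /= ?inord0;
    by field; rewrite ?t0 ?mN0 ?c0.
Qed.

Theorem theorem8p21 (R : realType) (a b d e g k c : R) :
  let f := fun v w : R => a * v ^+ 2 + b * v * w + d * w ^+ 2 + e * v + g * w + k in
  let psi := fun x : 'rV[R]_2 => mkrow 3 [:: x 0 0; x 0 1; f (x 0 0) (x 0 1)] in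
  let phi1 := fun x : 'rV[R]_3 =>
    mkrow 4 [:: x 0 0 * x 0 1; x 0 0 * x 0 2;
                x 0 0 * f (x 0 1) (x 0 2) - c * x 0 0 ^+ 4; x 0 0] in
  let phi2 := fun x : 'rV[R]_3 =>
    mkrow 4 [:: x 0 1; x 0 2; f (x 0 1) (x 0 2) + c * x 0 0 ^+ 3; x 0 0 ^+ 4] in
  let U := fun x : 'rV[R]_3 => 0 < x 0 0 in
  4 * a * d - b ^+ 2 < 0 ->
  is_blaschke_normal psi (fun _ => mkrow 3 [:: 0; 0; 1]) (fun _ => True) ->
  c != 0 ->
  forall phi, phi = phi1 \/ phi = phi2 ->
  exists xi : 'rV[R]_3 -> 'rV[R]_4,
    [/\ is_blaschke_normal phi xi U,
        improper_affine_hypersphere phi xi U,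
        indefinite phi xi U
      & pointwise_SO11_symmetry phi xi U].
Proof.
move=> f psi phi1 phi2 U hD hpsi c0 phi.
have disc := paraboloid_disc a b d e g k hD hpsi.
by case=> ->; [exact: cone_hypersurface|exact: graph_hypersurface].
Qed.
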